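(* Let $X$ be a countable discrete field of characteristic $0$. Let $\xi$ and $\eta$ be independent identically distributed random variables with values in $X$ and distribution $\mu$. If the random variables $S=\xi+\eta$ and $D=(\xi-\eta)^2$ are independent, then $\mu$ is a degenerate distribution.
   Context: A discrete field is a field with the discrete topology. A degenerate distribution on $X$ is a probability measure $E_x$ concentrated at a single point $x\in X$. The sum, difference and square are those of the field $X$. *)

(* Defs.v *)
From HB Require Import structures.
From mathcomp Require Import all_boot all_order all_algebra.
From mathcomp Require Import all_classical all_reals all_analysis.

Set Implicit Arguments.
Unset Strict Implicit.
Unset Printing Implicit Defensive.

Import Order.TTheory GRing.Theory Num.Theory.

Local Open Scope classical_set_scope.
Local Open Scope ring_scope.

(* The field operations are automatically continuous for the discrete topology,
   so no compatibility axiom is needed. *)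
#[short(type="discreteFieldType")]
HB.structure Definition DiscreteField :=
  {X of GRing.Field X & DiscreteTopology X}.

(* X equipped with its Borel sigma-algebra; the distinguished point 0 is only
   there because measurable types are pointed in the library. *)
Definition borel_field (X : discreteFieldType) : Type := X.

Section borel_field.
Variable X : discreteFieldType.

HB.instance Definition _ := GRing.Field.copy (borel_field X) X.
HB.instance Definition _ := isPointed.Build (borel_field X) 0.
HB.instance Definition _ := Measurable.copy (borel_field X)
  (g_sigma_algebraType (@open X : set (set (borel_field X)))).

End borel_field.

Section random_variables.
Context d (T : measurableType d) (R : realType) (P : probability T R).
Context d1 (T1 : measurableType d1) d2 (T2 : measurableType d2).

(* Independence of the random variables f and g. Measurability of f and g is
   left to the uses: a map into a countable discrete field built pointwise from
   random variables is automatically measurable. *)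
Definition independent (f : T -> T1) (g : T -> T2) : Prop :=
  forall (A : set T1) (B : set T2), measurable A -> measurable B ->
    P (f @^-1` A `&` g @^-1` B) = (P (f @^-1` A) * P (g @^-1` B))%E.

Definition has_distribution (f : {RV P >-> T1}) (mu : probability T1 R) : Prop :=
  forall A : set T1, measurable A -> distribution P f A = mu A.

Definition degenerate (mu : probability T1 R) : Prop :=
  exists x : T1, forall A : set T1, measurable A -> mu A = \d_x A.

End random_variables.

(* Main.v *)
Require Import Defs.
From HB Require Import structures.
From mathcomp Require Import all_boot all_order all_algebra.
From mathcomp Require Import all_classical all_reals all_analysis.
From mathcomp Require Import ring lra.

Import Order.TTheory GRing.Theory Num.Theory.

Local Open Scope classical_set_scope.
Local Open Scope ring_scope.

(** Let [p x] be the mass of [mu] at [x]. Since the characteristic is not 2,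
    every value of the pair (S, D) can be written (2a, (2b)^2), and it is taken
    exactly when (xi, eta) is (a + b, a - b) or (a - b, a + b). Independence of
    S and D therefore makes [p (a + b) * p (a - b)], up to the factor 2 present
    when b is nonzero, a product s(a) * t(b), and [p a ^+ 2] is s(a) * t(0).
    Eliminating s and t leaves
      p(a + b) p(a - b) p(c)^2 = p(c + b) p(c - b) p(a)^2,
    which is [mass_equation]: a Gaussian-type functional equation.

    Suppose that two distinct points carry mass, and write them a + b and
    a - b. The equation gives p(a) > 0, and h(t) = p(a + t) p(a - t) satisfies
    h(2t) p(a)^6 = h(t)^4. In normalized form g = h / p(a)^2 this reads
    g(2t) = g(t)^4, as for exp(-t^2): along b, b/2, b/4, ... the values of g
    cannot decrease below min(1, g(b)). Characteristic 0 makes the points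
    a + b/2^k pairwise distinct, so infinitely many points would carry a mass
    bounded below ([unique_positive_point]), which is absurd in a space of total
    mass 1 ([finitely_many_heavy_points]).

    So at most one point has positive mass, and on a countable space this makes
    [mu] a Dirac measure ([degenerate_unique_atom]). *)

(** Equality of two terms would make a nonzero difference of powers of 2 vanish
    in [F]. *)
Lemma injective_dyadic_fractions (F : fieldType) (b : F) :
  [pchar F] =i pred0 -> b != 0 -> injective (fun k => b / 2%:R ^+ k).
Proof.
move=> /pcharf0P char0 b0 i j /(mulfI b0)/invr_inj; rewrite -!natrX => eq_ij.
wlog le_ij : i j eq_ij / (i <= j)%N.
  by move=> H; case/orP: (leq_total i j) => ?; [|apply/esym]; apply: H.
apply/eqP; rewrite eqn_leq le_ij /= -(@leq_exp2l 2)// -subn_eq0 -char0.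
by rewrite natrB ?leq_exp2l// eq_ij subrr.
Qed.

(** The assumption on sequences is what remains of the summability of [p]. It
    fails for the dyadic sequence [a + b / 2 ^ k] as soon as [a + b] and [a - b]
    are two distinct points of positive mass, because there [p] looks like a
    Gaussian density near its centre. *)
Lemma unique_positive_point (F : fieldType) (R : realFieldType) (p : F -> R) :
  [pchar F] =i pred0 ->
  (forall x, 0 <= p x) -> (forall x, p x <= 1) ->
  (forall a b c,
    p (a + b) * p (a - b) * p c ^+ 2 = p (c + b) * p (c - b) * p a ^+ 2) ->
  (forall (e : R) (x : nat -> F), 0 < e -> injective x ->
    exists k, p (x k) < e) ->
  forall x y, 0 < p x -> 0 < p y -> x = y.
Proof.
move=> char0 p_ge0 p_le1 p_eq p_small x y px py.
have two0 : 2%:R != 0 :> F by rewrite (pcharf0P F).1.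
apply/eqP/negPn/negP => xy.
pose a := (x + y) / 2%:R; pose b := (x - y) / 2%:R.
have b0 : b != 0 by rewrite mulf_neq0 ?invr_eq0 ?subr_eq0.
have Dx : x = a + b by rewrite /a /b; field.
have Dy : y = a - b by rewrite /a /b; field.
have pa : 0 < p a.
  rewrite lt_neqAle p_ge0 andbT eq_sym; apply/eqP => pa0.
  have := p_eq a b x; rewrite -Dx -Dy pa0 expr0n /= mulr0 => /eqP.
  by rewrite !mulf_eq0 !gt_eqF.
pose h t := p (a + t) * p (a - t).
have h_ge0 t : 0 <= h t by rewrite mulr_ge0.
(* The functional equation centred at [a + t] and at [a - t], compared with the
   centre [a]; the two resulting identities are multiplied together. *)
have h_double t : h (t + t) * p a ^+ 6 = h t ^+ 4.
  have := p_eq (a + t) t a; rewrite addrK -addrA => E1.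
  have := p_eq (a - t) t a; rewrite subrK -addrA -opprD => E2.
  have -> : h (t + t) * p a ^+ 6 = (p (a + (t + t)) * p a * p a ^+ 2) *
      (p a * p (a - (t + t)) * p a ^+ 2) by rewrite /h; ring.
  by rewrite E1 E2 /h; ring.
(* [p a ^+ 2] is [h 0]. *)
pose e := Num.min (p a ^+ 2) (h b).
have e_gt0 : 0 < e.
  by rewrite lt_min exprn_gt0//= /h -Dx -Dy mulr_gt0.
have h_ge k : e <= h (b / 2%:R ^+ k).
  elim: k => [|k IH]; first by rewrite expr0 divr1 ge_min lexx orbT.
  set t := b / 2%:R ^+ k.+1.
  have Dt : b / 2%:R ^+ k = t + t by rewrite /t exprS; field; rewrite expf_neq0.
  rewrite Dt in IH; rewrite leNgt; apply/negP => ht.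
  have hle : h t <= p a ^+ 2 by rewrite (le_trans (ltW ht))// ge_min lexx.
  (* Below [h 0], halving the argument can only increase [h]. *)
  have : h (t + t) * p a ^+ 6 <= h t * p a ^+ 6.
    rewrite h_double exprS ler_wpM2l//.
    by rewrite -[6%N]/(2 * 3)%N exprM lerXn2r ?nnegrE ?exprn_ge0.
  rewrite ler_pM2r ?exprn_gt0// leNgt => /negP; apply.
  exact: lt_le_trans ht IH.
have inj : injective (fun k => a + b / 2%:R ^+ k).
  by move=> i j /addrI/injective_dyadic_fractions; apply.
have [k] := p_small _ _ e_gt0 inj; apply/negP; rewrite -leNgt.
by rewrite (le_trans (h_ge k))// /h ler_piMr.
Qed.

Lemma finitely_many_heavy_points {d} {Y : measurableType d} (R : realType)
    (mu : probability Y R) (e : R) (x : nat -> Y) :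
  (forall y : Y, measurable [set y]) -> 0 < e -> injective x ->
  exists k, (mu [set x k] < e%:E)%E.
Proof.
move=> m1 e0 x_inj; apply: contrapT => /forallNP heavy.
have [n en] : exists n, e^-1 < n%:R.
  by exists (Num.truncn e^-1).+1; exact: truncnS_gt.
have: (mu (\big[setU/set0]_(i < n) [set x i]) <= 1)%E.
  by apply: probability_le1; apply: bigsetU_measurable => i _.
rewrite (measure_bigsetU mu (fun i => m1 (x i)))//; last first.
  apply/trivIsetP => i j _ _ ij; apply/seteqP; split => //= z [->] /x_inj eij.
  by rewrite eij eqxx in ij.
apply/negP; rewrite -ltNge.
have: (\sum_(i < n) e%:E <= \sum_(i < n) mu [set x i])%E.
  by apply: lee_sum => i _; rewrite leNgt; apply/negP.
apply: lt_le_trans; rewrite sumEFin lte_fin sumr_const card_ord -mulr_natr.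
by rewrite -ltr_pdivrMl// mulr1.
Qed.

Lemma countable_null {d} {Y : measurableType d} (R : realType)
    (mu : {measure set Y -> \bar R}) (A : set Y) :
  (forall y : Y, measurable [set y]) -> countable A ->
  (forall y, A y -> mu [set y] = 0%E) -> mu A = 0%E.
Proof.
move=> m1 cA null; apply: measure_negligible.
  exact: countable_measurable.
have /countable_injP[f f_inj] := cA.
have -> : A = \bigcup_n (A `&` f @^-1` [set n]).
  apply/seteqP; split => [y Ay|y [n _ []]//]; by exists (f y).
apply: negligible_bigcup => n.
have [->|/set0P[y [Ay fy]]] := eqVneq (A `&` f @^-1` [set n]) set0.
  exact: negligible_set0.
apply: (@negligibleS _ _ _ _ [set y]); last by apply/negligibleP => //; apply: null.
by move=> z [Az fz] /=; apply: f_inj; rewrite ?inE//; move: fy fz => /= -> ->.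
Qed.

(** Countability enters twice: it forces an atom to exist, since the whole space
    is not null, and it makes the complement of that atom null. *)
Lemma degenerate_unique_atom {d} {Y : measurableType d} (R : realType)
    (mu : probability Y R) :
  (forall y : Y, measurable [set y]) -> countable [set: Y] ->
  (forall x y, mu [set x] != 0%E -> mu [set y] != 0%E -> x = y) ->
  degenerate mu.
Proof.
move=> m1 cY uniq.
have cA (A : set Y) : countable A by apply: sub_countable cY; exact: subset_card_le.
have mA (A : set Y) : measurable A by exact: countable_measurable.
have [x mux] : exists x, mu [set x] != 0%E.
  apply: contrapT => /forallNP none.
  have : mu [set: Y] = 0%E.
    by apply: countable_null => // y _; apply/eqP/negPn/negP/none.
  by rewrite probability_setT => /eqP; rewrite onee_eq0.
have null A : ~ A x -> mu A = 0%E.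
  move=> Ax; apply: countable_null => // y Ay; apply/eqP/negPn/negP => muy.
  by apply: Ax; rewrite (uniq x y).
exists x => A _; rewrite diracE; have [/set_mem Ax|/negP xA] := boolP (x \in A).
  rewrite -[LHS](@subeK _ _ (mu (~` A))) ?fin_num_measure//.
  have nA : mu (~` A) = 0%E by exact: null.
  have := probability_setC mu (mA A); rewrite nA => /esym/eqP.
  by rewrite sube_eq ?fin_num_measure// add0e sube0 adde0 => /eqP <-.
by apply: null => Ax; apply: xA; rewrite inE.
Qed.

Lemma measurable_borel_field (X : discreteFieldType) (A : set (borel_field X)) :
  measurable A.
Proof. by apply: sub_gen_smallest; exact: (@discrete_open X A). Qed.

(** For nonzero [b] both sides, doubled, are the same product of four
    probabilities: those of S = 2a, S = 2c, D = (2b)^2 and D = 0. They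
    are only permuted, which is legitimate in the extended reals. *)
Lemma mass_equation (X : discreteFieldType) (R : realType)
    (d : measure_display) (T : measurableType d) (P : probability T R)
    (mu : probability (borel_field X) R) (xi eta : {RV P >-> borel_field X})
    (p : borel_field X -> R) :
  2%:R != 0 :> X -> (forall x, mu [set x] = (p x)%:E) ->
  independent P xi eta -> has_distribution xi mu -> has_distribution eta mu ->
  independent P (fun w => xi w + eta w) (fun w => (xi w - eta w) ^+ 2) ->
  forall a b c : borel_field X,
    p (a + b) * p (a - b) * p c ^+ 2 = p (c + b) * p (c - b) * p a ^+ 2.
Proof.
move=> two0 muE xi_eta xi_mu eta_mu S_D a b c.
have mX := @measurable_borel_field X.
have [->|b0] := eqVneq b 0; first by rewrite !(addr0, subr0) -!expr2 mulrC.
have joint x y : P (xi @^-1` [set x] `&` eta @^-1` [set y]) =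
    (p x * p y)%:E.
  by rewrite EFinM -!muE xi_eta// -xi_mu// -eta_mu.
have mxi x : measurable (xi @^-1` [set x]).
  by rewrite -[X in measurable X]setTI; exact: measurable_funPT.
have meta x : measurable (eta @^-1` [set x]).
  by rewrite -[X in measurable X]setTI; exact: measurable_funPT.
pose s (u : borel_field X) := P ((fun w => xi w + eta w) @^-1` [set u + u]).
pose t (v : borel_field X) :=
  P ((fun w => (xi w - eta w) ^+ 2) @^-1` [set (v + v) ^+ 2]).
have solve (x y u v : borel_field X) :
    x + y = u + u -> x - y = v + v -> x = u + v /\ y = u - v.
  move=> E1 E2; split; apply: (mulIf two0).
    have -> : x * 2%:R = (x + y) + (x - y) by ring.
    by rewrite E1 E2; ring.
  have -> : y * 2%:R = (x + y) - (x - y) by ring.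
  by rewrite E1 E2; ring.
have diagonal u : ((p u * p u)%:E = s u * t 0%R)%E.
  rewrite -S_D// -joint; congr (P _); apply/seteqP; split => w /=.
    by move=> [-> ->]; rewrite subrr addr0.
  rewrite addr0 expr0n/= => -[E1 /eqP]; rewrite sqrf_eq0 => /eqP E2.
  have [] := solve (xi w) (eta w) u 0 E1; first by rewrite E2 addr0.
  by rewrite addr0 subr0.
have off_diagonal u :
    ((p (u + b) * p (u - b) *+ 2)%:E = s u * t b)%E.
  rewrite -S_D// mulr2n EFinD -{1}joint mulrC -joint -measureU; last 3 first.
  - exact: measurableI.
  - exact: measurableI.
  (* The two preimages of the value [(u + u, (b + b) ^+ 2)] are disjoint because
     [b] is not [- b]. *)
  - apply/seteqP; split => // w /= [[-> _] [/addrI E _]].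
    have : b * 2%:R = 0 by rewrite mulr_natr mulr2n {1}E addNr.
    by move=> /eqP; rewrite mulf_eq0 (negPf b0) (negPf two0).
  congr (P _); apply/seteqP; split => w /=.
    by move=> [[-> ->]|[-> ->]]; split; ring.
  move=> [E1 /eqP]; rewrite eqf_sqr => /orP[] /eqP E2.
    by left; exact: solve.
  right; have [||-> ->] := solve (xi w) (eta w) u (- b) => //.
    by rewrite E2 opprD.
  by rewrite opprK.
have : ((p (a + b) * p (a - b) *+ 2)%:E * (p c * p c)%:E =
        (p (c + b) * p (c - b) *+ 2)%:E * (p a * p a)%:E)%E.
  by rewrite !off_diagonal !diagonal muleACA [RHS]muleACA (muleC (s c)).
by rewrite -!EFinM => -[]; lra.
Qed.

Theorem theorem2 (X : discreteFieldType)
    (X_countable : countable [set: X])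
    (X_char0 : [pchar X] =i pred0)
    (R : realType) (d : measure_display) (T : measurableType d)
    (P : probability T R)
    (mu : probability (borel_field X) R)
    (xi eta : {RV P >-> borel_field X})
    (xi_eta_indep : independent P xi eta)
    (xi_mu : has_distribution xi mu)
    (eta_mu : has_distribution eta mu)
    (S_D_indep :
      independent P (fun w => xi w + eta w) (fun w => (xi w - eta w) ^+ 2)) :
  degenerate mu.
Proof.
have m1 (x : borel_field X) : measurable [set x] by exact: measurable_borel_field.
pose p (x : X) := fine (mu [set (x : borel_field X)]).
have pE x : mu [set x] = (p x)%:E by rewrite fineK ?fin_num_measure.
apply: degenerate_unique_atom => // x y.
have p_ge0 z : 0 <= p z by rewrite -lee_fin -pE.
have pos z : mu [set z] != 0%E -> 0 < p z.
  by rewrite pE eqe lt_neqAle p_ge0 andbT eq_sym.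
move=> /pos px /pos py; move: x y px py.
apply: (@unique_positive_point X R p) => //.
- by move=> z; rewrite -lee_fin -pE probability_le1.
- by apply: (mass_equation X R d T P mu xi eta p); rewrite ?(pcharf0P X).1.
- move=> e x e0 x_inj.
  have [k] := finitely_many_heavy_points R mu e x m1 e0 x_inj.
  by rewrite pE lte_fin; exists k.
Qed.
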